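(* Let $\Gamma = \langle a, b \mid a b a^2 b^{-1} a^2 b^{-2},\; a b^3 a b^4 a^{-1} b \rangle$. Let $A \subseteq \Gamma$ be the set of elements represented by the list $L_A$ of $32$ words, and $B \subseteq \Gamma$ the set of elements represented by the list $L_B$ of $28$ words, where $L_A$ and $L_B$ are the explicit lists given in the context. Then $|A| = 32$, $|B| = 28$, and each of the $32\cdot 28 = 896$ products coincides with another product: for every $(u,v) \in A \times B$ there exists $(u',v') \in A \times B$ with $(u',v') \neq (u,v)$ and $uv = u'v'$ in $\Gamma$.
   Context: Words are written in the letters $\mathtt{a}, \mathtt{b}, \mathtt{A}, \mathtt{B}$, where $\mathtt{a}=a$, $\mathtt{b}=b$, $\mathtt{A} = a^{-1}$, $\mathtt{B} = b^{-1}$, and $\varepsilon$ is the empty word (representing the identity). (Inside words, $\mathtt{A}$ and $\mathtt{B}$ denote inverse generators and are not the sets $A$, $B$.) A word represents the element of $\Gamma$ obtained by multiplying its letters from left to right. List $L_A$ (32 words): $\varepsilon$, $\mathtt{a}$, $\mathtt{A}$, $\mathtt{b}$, $\mathtt{ab}$, $\mathtt{aB}$, $\mathtt{Ab}$, $\mathtt{bb}$, $\mathtt{aba}$, $\mathtt{abb}$, $\mathtt{aBB}$, $\mathtt{AbA}$, $\mathtt{Abb}$, $\mathtt{abaa}$, $\mathtt{abab}$, $\mathtt{abbA}$, $\mathtt{abbb}$, $\mathtt{AbAb}$, $\mathtt{Abbb}$, $\mathtt{aabaa}$, $\mathtt{abaab}$, $\mathtt{bbAA}$, $\mathtt{ababb}$,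 $\mathtt{abbAA}$, $\mathtt{abbAb}$, $\mathtt{abbbb}$, $\mathtt{AbAA}$, $\mathtt{AbAbb}$, $\mathtt{bbAAB}$, $\mathtt{abaabb}$, $\mathtt{abbAbb}$, $\mathtt{AbAAb}$. List $L_B$ (28 words): $\varepsilon$, $\mathtt{A}$, $\mathtt{b}$, $\mathtt{B}$, $\mathtt{ab}$, $\mathtt{AA}$, $\mathtt{bA}$, $\mathtt{bb}$, $\mathtt{BA}$, $\mathtt{bAA}$, $\mathtt{bbA}$, $\mathtt{bbb}$, $\mathtt{Bab}$, $\mathtt{BBAB}$, $\mathtt{bbAA}$, $\mathtt{abbab}$, $\mathtt{AbAA}$, $\mathtt{BAbAA}$, $\mathtt{BBAAA}$, $\mathtt{BBABA}$, $\mathtt{BBBAB}$, $\mathtt{abbbbb}$, $\mathtt{babbab}$, $\mathtt{bbAbAA}$, $\mathtt{BBBAAA}$, $\mathtt{BBBABA}$, $\mathtt{BBABab}$, $\mathtt{bAbAA}$. *)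

(* Defs.v *)
From HB Require Import structures.
From mathcomp Require Import all_boot generic_quotient finmap boolp.

Set Implicit Arguments.
Unset Strict Implicit.
Unset Printing Implicit Defensive.

Local Open Scope fset_scope.
Local Open Scope group_scope.

(* The group < X | R >.  A letter (x, false) stands for the generator x and   *)
(* (x, true) for its inverse.                                                 *)

Definition letter (X : choiceType) := (X * bool)%type.
Definition word (X : choiceType) := seq (letter X).

Definition linv (X : choiceType) (l : letter X) : letter X := (l.1, ~~ l.2).
Definition winv (X : choiceType) (w : word X) : word X := rev (map (@linv X) w).

(* The least congruence on words containing l l^-1 ~ 1 for every letter l and *)
(* r ~ 1 for every relator r.                                                 *)
Inductive pres_eq (X : choiceType) (R : seq (word X)) :
    word X -> word X -> Prop :=
| pres_refl u : pres_eq R u u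
| pres_sym u v : pres_eq R u v -> pres_eq R v u
| pres_trans u v w : pres_eq R u v -> pres_eq R v w -> pres_eq R u w
| pres_cancel u l v : pres_eq R (u ++ [:: l; linv l] ++ v) (u ++ v)
| pres_rel u r v : r \in R -> pres_eq R (u ++ r ++ v) (u ++ v).

Section PresentedGroup.
Variables (X : choiceType) (R : seq (word X)).

Lemma linvK : involutive (@linv X).
Proof. by case=> x e; rewrite /linv /= negbK. Qed.

Lemma winvK : involutive (@winv X).
Proof. by move=> w; rewrite /winv map_rev revK (mapK linvK). Qed.

Lemma winv_cat (u v : word X) : winv (u ++ v) = winv v ++ winv u.
Proof. by rewrite /winv map_cat rev_cat. Qed.

Lemma pres_catl (w u v : word X) :
  pres_eq R u v -> pres_eq R (w ++ u) (w ++ v).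
Proof.
elim=> {u v} [u|u v _|u v x _ + _|u l v|u r v Rr].
- exact: pres_refl.
- exact: pres_sym.
- exact: pres_trans.
- by have := pres_cancel R (w ++ u) l v; rewrite -!catA.
- by have := pres_rel (w ++ u) v Rr; rewrite -!catA.
Qed.

Lemma pres_catr (w u v : word X) :
  pres_eq R u v -> pres_eq R (u ++ w) (v ++ w).
Proof.
elim=> {u v} [u|u v _|u v x _ + _|u l v|u r v Rr].
- exact: pres_refl.
- exact: pres_sym.
- exact: pres_trans.
- by have := pres_cancel R u l (v ++ w); rewrite -!catA.
- by have := pres_rel u (v ++ w) Rr; rewrite -!catA.
Qed.

Lemma pres_cat (u u' v v' : word X) :
  pres_eq R u u' -> pres_eq R v v' -> pres_eq R (u ++ v) (u' ++ v').
Proof.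
by move=> uu' vv'; apply: pres_trans (pres_catl _ vv'); apply: pres_catr.
Qed.

Lemma pres_mulV (w : word X) : pres_eq R (w ++ winv w) [::].
Proof.
elim: w => [|l w IHw]; first exact: pres_refl.
rewrite -cat1s winv_cat -catA (catA w).
apply: (pres_trans (v := [:: l] ++ [::] ++ winv [:: l])).
  exact/pres_catl/pres_catr.
exact: (pres_cancel R [::] l [::]).
Qed.

Lemma pres_Vmul (w : word X) : pres_eq R (winv w ++ w) [::].
Proof. by have := pres_mulV (winv w); rewrite winvK. Qed.

Lemma pres_winv (u v : word X) :
  pres_eq R u v -> pres_eq R (winv u) (winv v).
Proof.
move=> uv; apply: (pres_trans (v := winv u ++ (v ++ winv v))).
  by rewrite -{1}[winv u]cats0; apply/pres_catl/pres_sym/pres_mulV.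
apply: (pres_trans (v := winv u ++ (u ++ winv v))).
  exact/pres_catl/pres_catr/pres_sym.
by rewrite catA; apply: (pres_catr (winv v) (pres_Vmul u)).
Qed.

Definition pres_eqb (u v : word X) : bool := `[< pres_eq R u v >].

Lemma pres_eqb_refl : reflexive pres_eqb.
Proof. by move=> u; apply/asboolP/pres_refl. Qed.

Lemma pres_eqb_sym : symmetric pres_eqb.
Proof. by move=> u v; apply/asboolP/asboolP; apply: pres_sym. Qed.

Lemma pres_eqb_trans : transitive pres_eqb.
Proof.
move=> v u w /asboolP uv /asboolP vw; apply/asboolP; exact: pres_trans uv vw.
Qed.

Canonical pres_equiv := EquivRel pres_eqb
  pres_eqb_refl pres_eqb_sym pres_eqb_trans.

Definition presented := {eq_quot pres_eqb}%qT.
HB.instance Definition _ := Choice.on presented.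

Definition pres_class (w : word X) : presented := (\pi_({eq_quot pres_eqb}) w)%qT.

Lemma pres_classP (u v : word X) :
  pres_class u = pres_class v <-> pres_eq R u v.
Proof.
split; first by move/eqmodP/asboolP.
by move=> uv; apply/eqmodP/asboolP.
Qed.

Lemma pres_class_repr (x : presented) : pres_class (repr x) = x.
Proof. exact: reprK. Qed.

Lemma pres_repr_class (w : word X) : pres_eq R (repr (pres_class w)) w.
Proof. by apply/pres_classP; rewrite pres_class_repr. Qed.

Definition pres_one : presented := pres_class [::].
Definition pres_mul (x y : presented) : presented :=
  pres_class (repr x ++ repr y).
Definition pres_inv (x : presented) : presented := pres_class (winv (repr x)).

Lemma pres_mul_class (u v : word X) :
  pres_mul (pres_class u) (pres_class v) = pres_class (u ++ v).
Proof. by apply/pres_classP/pres_cat; apply: pres_repr_class. Qed.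

Lemma pres_inv_class (u : word X) :
  pres_inv (pres_class u) = pres_class (winv u).
Proof. exact/pres_classP/pres_winv/pres_repr_class. Qed.

Lemma pres_mulA : associative pres_mul.
Proof.
move=> x y z; rewrite -(pres_class_repr x) -(pres_class_repr y).
by rewrite -(pres_class_repr z) !pres_mul_class catA.
Qed.

Lemma pres_mul1g : left_id pres_one pres_mul.
Proof. by move=> x; rewrite -(pres_class_repr x) pres_mul_class. Qed.

Lemma pres_mulg1 : right_id pres_one pres_mul.
Proof. by move=> x; rewrite -(pres_class_repr x) pres_mul_class cats0. Qed.

Lemma pres_mulVg : left_inverse pres_one pres_inv pres_mul.
Proof.
move=> x; rewrite -(pres_class_repr x) pres_inv_class pres_mul_class.
exact/pres_classP/pres_Vmul.
Qed.

Lemma pres_mulgV : right_inverse pres_one pres_inv pres_mul.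
Proof.
move=> x; rewrite -(pres_class_repr x) pres_inv_class pres_mul_class.
exact/pres_classP/pres_mulV.
Qed.

HB.instance Definition _ := isGroup.Build presented
  pres_mulA pres_mul1g pres_mulg1 pres_mulVg pres_mulgV.

Definition pres_gen (x : X) : presented := pres_class [:: (x, false)].

Definition letter_val (l : letter X) : presented :=
  if l.2 then (pres_gen l.1)^-1 else pres_gen l.1.

Definition word_val (w : word X) : presented := \prod_(l <- w) letter_val l.

Lemma letter_valE (l : letter X) : letter_val l = pres_class [:: l].
Proof. by case: l => x [] //; exact: pres_inv_class. Qed.

Lemma word_valE (w : word X) : word_val w = pres_class w.
Proof.
rewrite /word_val; elim: w => [|l w IHw]; first by rewrite big_nil.
by rewrite big_cons IHw letter_valE; exact: pres_mul_class.
Qed.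

Lemma word_valP (u v : word X) : word_val u = word_val v <-> pres_eq R u v.
Proof. by rewrite !word_valE; exact: pres_classP. Qed.

End PresentedGroup.

Arguments word_val {X} R w.

Local Notation a := ((false, false) : letter bool).
Local Notation A := ((false, true) : letter bool).
Local Notation b := ((true, false) : letter bool).
Local Notation B := ((true, true) : letter bool).

Definition relators : seq (word bool) :=
  [:: [:: a; b; a; a; B; a; a; B; B];
      [:: a; b; b; b; a; b; b; b; b; A; b]].

Definition Gamma : groupType := presented relators.

Definition LA : seq (word bool) :=
  [:: [::];
      [:: a]; [:: A]; [:: b]; [:: a; b]; [:: a; B]; [:: A; b]; [:: b; b];
      [:: a; b; a]; [:: a; b; b]; [:: a; B; B]; [:: A; b; A]; [:: A; b; b];
      [:: a; b; a; a]; [:: a; b; a; b]; [:: a; b; b; A]; [:: a; b; b; b];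
      [:: A; b; A; b]; [:: A; b; b; b]; [:: a; a; b; a; a];
      [:: a; b; a; a; b]; [:: b; b; A; A]; [:: a; b; a; b; b];
      [:: a; b; b; A; A]; [:: a; b; b; A; b]; [:: a; b; b; b; b];
      [:: A; b; A; A]; [:: A; b; A; b; b]; [:: b; b; A; A; B];
      [:: a; b; a; a; b; b]; [:: a; b; b; A; b; b]; [:: A; b; A; A; b]].

Definition LB : seq (word bool) :=
  [:: [::];
      [:: A]; [:: b]; [:: B]; [:: a; b]; [:: A; A]; [:: b; A]; [:: b; b];
      [:: B; A]; [:: b; A; A]; [:: b; b; A]; [:: b; b; b]; [:: B; a; b];
      [:: B; B; A; B]; [:: b; b; A; A]; [:: a; b; b; a; b]; [:: A; b; A; A];
      [:: B; A; b; A; A]; [:: B; B; A; A; A]; [:: B; B; A; B; A];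
      [:: B; B; B; A; B]; [:: a; b; b; b; b; b]; [:: b; a; b; b; a; b];
      [:: b; b; A; b; A; A]; [:: B; B; B; A; A; A]; [:: B; B; B; A; B; A];
      [:: B; B; A; B; a; b]; [:: b; A; b; A; A]].

Definition setA : {fset Gamma} := [fset (word_val relators w : Gamma) | w in LA].
Definition setB : {fset Gamma} := [fset (word_val relators w : Gamma) | w in LB].

(* Main.v *)
(* The images of the words of [LB] in the abelianization Z/42 are distinct,   *)
(* and those of [LA] become distinct after adding the images of a point under *)
(* an action of Gamma on the affine plane over F_2 (a quotient onto A_4).     *)
(* Every product uv is paired with another product u'v' such that the word    *)
(* uv(u'v')^-1 is freely trivial or, up to cyclic conjugation and inversion,  *)
(* one of the two relators or of seven products of at most five conjugates of *)
(* them, which come from a partial enumeration of the Cayley complex.         *)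

Require Import Defs.
From mathcomp Require Import all_boot finmap ssralg zmodp.

Set Implicit Arguments.
Unset Strict Implicit.
Unset Printing Implicit Defensive.

Local Open Scope fset_scope.
Local Open Scope group_scope.

(** Only two one-sided parts of the word problem of [Gamma] are needed. Inequalities come from
    invariants: letters acting by mutually inverse maps, with trivial relators, give an action of
    the group ([pres_eq_foldl]), and two such actions separate the words of each list
    ([word_val_inj_in]). Equalities come from certificates: a product of conjugates of relators is
    trivial, and triviality survives free reduction and cyclic conjugation ([cyclic_conjugate_eq1]),
    so [collision] becomes a finite check over a table of partners. Injectivity on the two lists is
    used again at the end: it turns distinct pairs of words into distinct pairs of elements. *)

Section Presentations.
Variables (X : choiceType) (R : seq (word X)).
Implicit Types (l : letter X) (u v w r : word X) (S : seq (word X)).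

Lemma pres_eq_foldl (T : Type) (act : T -> letter X -> T) :
    (forall l x, act (act x l) (linv l) = x) ->
    (forall r x, r \in R -> foldl act x r = x) ->
  forall u v x, pres_eq R u v -> foldl act x u = foldl act x v.
Proof.
move=> actK actR u v x uv; elim: uv x => {u v}
  [//|u v _ IH x|u v w _ IHu _ IHv x|u l v x|u r v Rr x].
- exact/esym/IH.
- by rewrite IHu.
- by rewrite !foldl_cat /= actK.
- by rewrite !foldl_cat (actR r).
Qed.

(** * Free reduction and consequences of the relators *)

Fixpoint free_reduce w : word X :=
  if w is l :: w' then
    let s := free_reduce w' in
    if s is l' :: s' then if l' == linv l then s' else l :: s else [:: l]
  else [::].

Lemma pres_free_reduce w : pres_eq R w (free_reduce w).
Proof.
elim: w => [|l w IHw] /=; first exact: pres_refl.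
apply: pres_trans (pres_catl [:: l] IHw) _.
case: (free_reduce w) => [|l' s] /=; first exact: pres_refl.
case: eqP => [->|_]; last exact: pres_refl.
exact: (pres_cancel R [::] l s).
Qed.

Lemma pres_conj_eq1 u v :
  pres_eq R v [::] -> pres_eq R (u ++ v ++ winv u) [::].
Proof.
move=> v1; apply: pres_trans (pres_mulV R u).
exact: pres_catl (pres_catr _ v1).
Qed.

(** Since vu = u^-1 (uv) u, triviality depends only on the cyclic word. *)
Lemma pres_catC_eq1 u v : pres_eq R (u ++ v) [::] -> pres_eq R (v ++ u) [::].
Proof.
move=> uv1; apply: pres_trans (pres_Vmul R u).
apply: (pres_trans (v := (winv u ++ u) ++ v ++ u)).
  exact/pres_sym/(pres_catr (v ++ u) (pres_Vmul R u)).
rewrite -catA; apply: pres_catl.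
by rewrite catA; exact: (pres_catr u uv1).
Qed.

Lemma pres_cat_winv_eq1 u v :
  pres_eq R (u ++ winv v) [::] -> pres_eq R u v.
Proof.
move=> uv1; apply: (pres_trans (v := (u ++ winv v) ++ v)); last exact: (pres_catr v uv1).
by rewrite -{1}[u]cats0 -catA; apply/pres_catl/pres_sym/pres_Vmul.
Qed.

Lemma pres_winv_eq1 w : pres_eq R w [::] -> pres_eq R (winv w) [::].
Proof. exact: (@pres_winv _ _ w [::]). Qed.

Definition symmetrized S := S ++ map (@winv X) S.

Lemma pres_symmetrized_eq1 S :
    (forall w, w \in S -> pres_eq R w [::]) ->
  forall w, w \in symmetrized S -> pres_eq R w [::].
Proof.
move=> S1 w; rewrite mem_cat => /orP[/S1 //|/mapP[v /S1 v1 ->]].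
exact: pres_winv_eq1.
Qed.

Lemma pres_relator_eq1 r : r \in R -> pres_eq R r [::].
Proof. by move=> Rr; have := pres_rel [::] [::] Rr; rewrite cats0. Qed.

(** Each pair is a conjugator followed by the word it conjugates; these products make up the normal
    closure of the relators. *)
Definition conj_prod (c : seq (word X * word X)) : word X :=
  flatten [seq p.1 ++ p.2 ++ winv p.1 | p <- c].

Lemma pres_conj_prod_eq1 c :
    (forall p, p \in c -> pres_eq R p.2 [::]) -> pres_eq R (conj_prod c) [::].
Proof.
elim: c => [|p c IHc] c1; first exact: pres_refl.
apply: (@pres_cat _ _ _ [::] _ [::]).
  by apply/pres_conj_eq1/c1; rewrite mem_head.
by apply: IHc => q cq; apply: c1; rewrite inE cq orbT.
Qed.

(* Iterating "rotate by one letter and freely reduce" cyclically reduces a    *)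
(* word and then runs through all its cyclic conjugates.                      *)
Definition cyclic_conjugate_of S w : bool :=
  has (mem ([::] :: symmetrized S))
      (traject (free_reduce \o rot 1) (free_reduce w) (size w).*2).

Lemma cyclic_conjugate_eq1 S w :
    (forall r, r \in S -> pres_eq R r [::]) ->
  cyclic_conjugate_of S w -> pres_eq R w [::].
Proof.
move=> S1 /hasP[q /trajectP[n _ ->] q1].
apply: (pres_trans (pres_free_reduce w)).
move: (free_reduce w) q1 => {}w; elim: n w => [|n IHn] w.
  rewrite /= inE => /predU1P[->|]; first exact: pres_refl.
  exact: pres_symmetrized_eq1.
(* Triviality is pulled back along the trajectory: undo one reduction, then one rotation. *)
rewrite iterSr => /IHn w1; rewrite -[w](cat_take_drop 1).
by apply/pres_catC_eq1/(pres_trans _ w1)/pres_free_reduce.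
Qed.

End Presentations.

(** * Invariants and certificates for [Gamma] *)

Local Notation a := ((false, false) : letter bool).
Local Notation A := ((false, true) : letter bool).
Local Notation b := ((true, false) : letter bool).
Local Notation B := ((true, true) : letter bool).

(* In the abelianization the relators read 5a = 2b and a = -8b, so it is     *)
(* cyclic of order 42, generated by b with a = 34 b.                          *)
Definition ab_act (x : 'Z_42) (l : letter bool) : 'Z_42 :=
  (x + match l with
       | (false, false) => 34%:R
       | (false, true) => 8%:R
       | (true, false) => 1%:R
       | (true, true) => 41%:R
       end)%R.

(* The linear part of order 3 is multiplication by a generator of F_4^*;      *)
(* [b] acts by it and [a] by its composite with a translation.                *)
Definition tetra_act (x : bool * bool) (l : letter bool) : bool * bool :=
  match l with
  | (false, false) => (~~ x.2, x.1 (+) x.2)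
  | (false, true) => (~~ x.1 (+) x.2, ~~ x.1)
  | (true, false) => (x.2, x.1 (+) x.2)
  | (true, true) => (x.1 (+) x.2, x.1)
  end.

Definition rel1 : word bool := nth [::] relators 0.
Definition rel2 : word bool := nth [::] relators 1.

Definition conjugate_certs : seq (seq (word bool * word bool)) :=
  [:: [:: ([:: B; A; b; A; A; B; A], winv rel1);
          ([::], winv rel2)];
      [:: ([:: B; A; b; A; A; B; A], winv rel1);
          ([::], winv rel2);
          ([:: b; b; A; A; b; A; A; B; A], rel1)];
      [:: ([:: a; B; B; B; B; B; A], winv rel2);
          ([:: A; b; A; A; B; A], rel1)];
      [:: ([:: a; b; a; a; B; B; B; A], rel2);
          ([::], rel1)];
      [:: ([:: a; b; a; a; B; B; A], winv rel1);
          ([::], rel1);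
          ([:: A], rel1)];
      [:: ([:: a; a; b; a; a; B; B; A], winv rel1);
          ([:: a], rel1);
          ([::], rel1);
          ([:: b; b; A; A; B; B; B; B; A], rel2)];
      [:: ([:: a; b; a; a; B; B; A], winv rel1);
          ([::], rel1);
          ([:: b; a; a; B; B], rel2);
          ([:: A], rel1);
          ([:: A; b; b; A; A; B; B; A; b; A; A; B; A], rel1)]].

Definition derived_relators : seq (word bool) :=
  relators ++ [seq free_reduce (conj_prod c) | c <- conjugate_certs].

Definition products : seq (word bool * word bool) :=
  [seq (u, v) | u <- LA, v <- LB].

(* Both positions and entries are indices into [products].                   *)
Definition partner : seq nat :=
 ([:: 29; 33; 60; 265; 30; 57; 85; 86; 271; 44; 90; 91; 278; 104; 93; 256; 65;
      274; 108; 109; 262; 263; 99; 111; 275; 266; 105; 100; 115; 0; 4; 140;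
      124; 1; 113; 114; 141; 117; 118; 119; 144; 132; 121; 162; 9; 156; 136;
      137; 153; 166; 127; 139; 158; 159; 133; 128; 1; 5; 168; 209; 2; 214; 169;
      170; 215; 16; 174; 175; 222; 188; 177; 200; 185; 218; 192; 193; 206; 207;
      183; 195; 219; 210; 189; 184; 2; 6; 7; 0; 208; 9; 10; 11; 1; 14; 202;
      203; 4; 216; 205; 22; 27; 16; 220; 221; 13; 26; 211; 223; 18; 19; 217;
      23; 4; 34; 35; 28; 226; 37; 38; 39; 0; 42; 258; 259; 32; 272; 261; 50;
      55; 9; 276; 277; 41; 627; 267; 279; 46; 47; 273; 51; 31; 36; 28; 280; 40;
      289; 0; 4; 281; 1; 34; 35; 284; 48; 37; 302; 45; 296; 52; 53; 293; 306;
      43; 55; 298; 299; 49; 9; 58; 62; 63; 1; 348; 16; 66; 67; 5; 70; 342; 343;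
      2; 356; 345; 78; 83; 72; 360; 361; 69; 82; 351; 363; 74; 75; 357; 79; 7;
      10; 11; 2; 71; 14; 94; 95; 6; 98; 76; 77; 88; 59; 81; 106; 23; 27; 61;
      64; 97; 110; 73; 80; 102; 103; 68; 107; 365; 4; 116; 825; 366; 34; 393;
      394; 831; 380; 398; 399; 838; 412; 401; 816; 42; 834; 416; 417; 822; 823;
      407; 419; 835; 826; 413; 408; 35; 38; 39; 4; 15; 42; 122; 123; 34; 126;
      454; 21; 116; 3; 457; 134; 51; 55; 5; 8; 125; 138; 463; 475; 130; 131;
      12; 135; 143; 148; 31; 881; 152; 886; 36; 28; 887; 145; 0; 4; 894; 160;
      1; 872; 157; 890; 164; 165; 878; 879; 155; 9; 891; 882; 22; 45; 62; 16;
      476; 517; 63; 522; 477; 478; 523; 83; 482; 483; 530; 496; 485; 508; 493;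
      526; 500; 501; 514; 515; 491; 503; 527; 518; 497; 492; 63; 66; 67; 58;
      516; 70; 178; 179; 62; 182; 510; 511; 172; 524; 513; 190; 79; 83; 528;
      529; 181; 194; 519; 531; 186; 187; 525; 191; 563; 224; 228; 14; 572; 4;
      561; 562; 589; 565; 566; 567; 592; 580; 569; 610; 233; 604; 584; 585;
      601; 614; 575; 587; 606; 607; 581; 576; 116; 230; 231; 224; 628; 233;
      234; 235; 4; 238; 622; 623; 228; 636; 625; 246; 251; 42; 640; 641; 237;
      250; 631; 643; 242; 243; 637; 247; 38; 42; 648; 713; 39; 645; 673; 674;
      719; 51; 678; 679; 726; 692; 681; 704; 653; 722; 696; 697; 710; 711; 687;
      699; 723; 714; 693; 688; 39; 122; 123; 35; 712; 126; 262; 21; 38; 266;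
      706; 707; 15; 720; 709; 274; 135; 51; 724; 725; 3; 12; 715; 727; 5; 8;
      721; 275; 310; 314; 315; 62; 768; 83; 318; 319; 16; 322; 762; 763; 63;
      776; 765; 330; 335; 324; 780; 781; 321; 334; 771; 783; 326; 327; 777;
      331; 67; 178; 179; 63; 323; 182; 346; 347; 66; 350; 328; 329; 340; 311;
      333; 358; 191; 79; 313; 316; 349; 362; 325; 332; 354; 355; 320; 359; 646;
      650; 651; 42; 799; 32; 654; 655; 425; 658; 804; 805; 422; 787; 809; 666;
      671; 660; 789; 792; 657; 670; 801; 808; 662; 663; 796; 667; 228; 370;
      371; 364; 824; 373; 374; 375; 224; 378; 818; 819; 368; 832; 821; 386;
      391; 233; 836; 837; 377; 390; 827; 839; 382; 383; 833; 387; 14; 790; 791;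
      784; 376; 793; 794; 795; 785; 798; 370; 371; 788; 384; 373; 806; 811;
      800; 388; 389; 797; 810; 379; 391; 802; 803; 385; 807; 231; 234; 235;
      116; 50; 238; 402; 403; 230; 406; 41; 133; 396; 28; 47; 414; 247; 251;
      37; 0; 405; 418; 9; 46; 410; 411; 32; 415; 42; 425; 532; 853; 422; 858;
      533; 534; 859; 436; 538; 539; 866; 552; 541; 844; 549; 862; 556; 557;
      850; 851; 547; 559; 863; 854; 553; 548; 422; 426; 427; 38; 852; 51; 430;
      431; 42; 434; 846; 847; 39; 860; 849; 442; 447; 436; 864; 865; 433; 446;
      855; 867; 438; 439; 861; 443; 123; 262; 21; 39; 435; 266; 458; 459; 122;
      462; 440; 441; 452; 423; 445; 470; 275; 135; 425; 428; 461; 474; 437;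
      444; 466; 467; 432; 471; 16; 313; 868; 769; 310; 774; 869; 870; 775; 324;
      874; 875; 782; 888; 877; 760; 885; 145; 892; 893; 766; 767; 883; 895;
      779; 770; 889; 884; 315; 318; 319; 310; 743; 322; 486; 487; 314; 490;
      748; 749; 480; 731; 753; 498; 331; 335; 733; 736; 489; 502; 745; 752;
      494; 495; 740; 499; 591; 596; 14; 545; 600; 550; 589; 590; 551; 593; 594;
      595; 558; 608; 597; 536; 605; 554; 612; 613; 542; 543; 603; 615; 555;
      546; 609; 604; 371; 374; 375; 228; 239; 378; 570; 571; 370; 574; 244;
      245; 564; 227; 249; 582; 387; 391; 34; 232; 573; 586; 241; 248; 578; 579;
      236; 583; 427; 430; 431; 422; 659; 434; 682; 683; 426; 686; 664; 665;
      676; 647; 669; 694; 443; 447; 649; 652; 685; 698; 661; 668; 690; 691;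
      656; 695; 730; 734; 735; 16; 295; 324; 738; 739; 313; 742; 300; 301; 310;
      283; 305; 750; 755; 744; 285; 288; 741; 754; 297; 304; 746; 747; 292;
      751]%N).

(** * Separating the elements of each list *)

Lemma ab_actK l x : ab_act (ab_act x l) (linv l) = x.
Proof.
case: l => [] [] [] /=; rewrite /ab_act /= -GRing.addrA -[RHS]GRing.addr0;
  congr (_ + _)%R; exact/val_inj.
Qed.

(** Letters act by translations, so a relator has to be tested at 0 only. *)
Lemma foldl_ab_act x w : foldl ab_act x w = (x + foldl ab_act 0 w)%R.
Proof.
elim/last_ind: w => [|w l IHw]; first by rewrite /= GRing.addr0.
by rewrite !foldl_rcons IHw /ab_act GRing.addrA.
Qed.

Lemma ab_act_relator r x : r \in relators -> foldl ab_act x r = x.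
Proof.
move=> Rr; rewrite foldl_ab_act -[RHS]GRing.addr0; congr (_ + _)%R.
by apply/eqP; move: r Rr; apply/allP; vm_compute.
Qed.

Lemma tetra_actK l x : tetra_act (tetra_act x l) (linv l) = x.
Proof. by case: l => [] [] []; case: x => [] [] []. Qed.

Lemma tetra_act_relator r x : r \in relators -> foldl tetra_act x r = x.
Proof. by rewrite !inE => /orP[]/eqP->; case: x => [] [] []. Qed.

Definition word_code (w : word bool) : nat * (bool * bool) :=
  (val (foldl ab_act 0%R w), foldl tetra_act (false, false) w).

Lemma word_code_val u v :
  word_val relators u = word_val relators v -> word_code u = word_code v.
Proof.
move/word_valP => uv; congr (val _, _); apply: pres_eq_foldl uv.
- exact: ab_actK.
- exact: ab_act_relator.
- exact: tetra_actK.
- exact: tetra_act_relator.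
Qed.

(** Equal elements have equal codes, and distinct codes along [s] then force equal positions in
    [s]. *)
Lemma word_val_inj_in (s : seq (word bool)) :
  uniq (map word_code s) -> {in s &, injective (word_val relators)}.
Proof.
move=> s_uniq u v su sv /word_code_val uv.
rewrite -(nth_index [::] su) -(nth_index [::] sv); congr nth; apply/eqP.
rewrite -(nth_uniq (word_code [::]) _ _ s_uniq) ?size_map ?index_mem //.
by rewrite !(nth_map [::]) ?index_mem // !nth_index // uv.
Qed.

Lemma card_word_val (s : seq (word bool)) :
    uniq s -> {in s &, injective (word_val relators)} ->
  #|` [fset (word_val relators w : Gamma) | w in s]| = size s.
Proof. by move=> s_uniq inj; rewrite card_in_imfset //= undup_id. Qed.

Lemma word_val_inj_LA : {in LA &, injective (word_val relators)}.
Proof. by apply: word_val_inj_in; vm_compute. Qed.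

Lemma word_val_inj_LB : {in LB &, injective (word_val relators)}.
Proof. by apply: word_val_inj_in; vm_compute. Qed.

(** * Coincidences between products *)

Lemma derived_relators_eq1 r :
  r \in derived_relators -> pres_eq relators r [::].
Proof.
rewrite mem_cat => /orP[/pres_relator_eq1 //|/mapP[c c_cert ->]].
apply: pres_trans (pres_sym (pres_free_reduce _ _)) _.
apply: pres_conj_prod_eq1 => p cp.
have /allP/(_ _ c_cert)/allP/(_ _ cp) :
  all (all (fun p => p.2 \in symmetrized relators)) conjugate_certs by vm_compute.
apply: pres_symmetrized_eq1; exact: pres_relator_eq1.
Qed.

Definition collide (p q : word bool * word bool) : bool :=
  cyclic_conjugate_of derived_relators ((p.1 ++ p.2) ++ winv (q.1 ++ q.2)).

Definition partner_ok (k k' : nat) : bool :=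
  let p := nth ([::], [::]) products k in
  let q := nth ([::], [::]) products k' in
  [&& k' < size products, q != p & collide p q].

(** Index 28 i + j stands for the i-th word of [LA] and the j-th of [LB]; for instance 0, the pair
    of empty words, has partner 29, the pair (a, A). *)
Lemma all_partner_ok :
  all (fun k => partner_ok k (nth 0 partner k)) (iota 0 (size products)).
Proof. by vm_compute. Qed.

Lemma collision u v : u \in LA -> v \in LB ->
  exists u' v', [/\ u' \in LA, v' \in LB, (u', v') <> (u, v) &
    word_val relators u * word_val relators v =
    word_val relators u' * word_val relators v' :> Gamma].
Proof.
move=> LAu LBv; have uvP: (u, v) \in products by exact: allpairs_f.
have /(allP all_partner_ok) : index (u, v) products \in iota 0 (size products).
  by rewrite mem_iota index_mem.
rewrite /partner_ok nth_index //; set k' := nth 0 _ _ => /and3P[k'_lt].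
have := mem_nth ([::], [::]) k'_lt.
case: (nth _ products k') => _ _ /allpairsP[[u' v'] [/= LAu' LBv' [-> ->]]] neq.
move/(cyclic_conjugate_eq1 derived_relators_eq1)/pres_cat_winv_eq1 => eq_prod.
exists u', v'; split=> //; last by rewrite -!big_cat; exact/word_valP.
by move=> eq_uv; rewrite eq_uv eqxx in neq.
Qed.

Theorem mainTheorem2 :
  [/\ #|` setA| = 32%N, #|` setB| = 28%N &
      forall u v : Gamma, u \in setA -> v \in setB ->
        exists u' v' : Gamma,
          [/\ u' \in setA, v' \in setB, (u', v') <> (u, v) & u * v = u' * v']].
Proof.
split.
- by rewrite card_word_val //; exact: word_val_inj_LA.
- by rewrite card_word_val //; exact: word_val_inj_LB.
move=> _ _ /imfsetP[u /= LAu ->] /imfsetP[v /= LBv ->].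
have [u' [v' [LAu' LBv' neq eq_uv]]] := collision LAu LBv.
exists (word_val relators u'), (word_val relators v'); split=> //.
- exact: in_imfset.
- exact: in_imfset.
(* [neq] concerns words; equal elements would give equal words by injectivity on the lists. *)
case=> /word_val_inj_LA eq_u /word_val_inj_LB eq_v.
by apply: neq; rewrite eq_u // eq_v.
Qed.
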